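(* For $n\ge2$ and $1\le i<j\le n$ let $z_{n,i,j}=\sum_\pi y^{\mu(\pi)}$, the sum over all $\pi\in\mathcal{D}_{3\text{-}12}(n)$ whose last cycle (in standard cycle form) starts with $i$ and ends with $j$. Let $Z(x,u,v)=\sum_{n\ge2}\sum_{i=1}^{n-1}\sum_{j=i+1}^n z_{n,i,j}u^{n-1-i}v^{n-j}x^n$, let $Z_m(x,u,v)=[y^m]Z(x,u,v)$ for $m\ge1$, and $Z_0=0$. Define $Z'_1(x,u)=x^2$ and, for $m\ge2$, $$Z'_m(x,u)=(-x)^{m+1}+xZ_{m-1}(x,1,u)-\sum_{j=2}^{m-1}(-x)^jZ_{m-j}(x,1,1).$$ Then for every $m\ge1$, \begin{align*} Z_m(x,u,v)&=\frac{1-v}{1-v-xuv}Z'_m(x,u)-\frac{xuv^2}{1-v-xuv}\sum_{j\ge0}\frac{(xuv)^j}{\prod_{i=1}^{j+1}(1-ixuv)}Z'_m\Big(x,\frac{uv}{1-(j+1)xuv}\Big)\\ &\quad+\frac{xu(1-v)}{1-v-xuv}\sum_{j\ge0}\frac{(xu)^j}{\prod_{i=1}^{j+1}(1-ixu)}Z'_m\Big(x,\frac{u}{1-(j+1)xu}\Big). \end{align*} (Thus $Z_m$ enumerates members of $\mathcal{D}_{3\text{-}12}(n)$, $n\ge2m$, with exactly $m$ cycles, $u$ marking $n-1-i$ and $v$ marking $n-j$.)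
   Context: Every permutation $\pi$ of $[n]=\{1,\dots,n\}$ is written in standard cycle form: each cycle is written starting with its smallest element, and the cycles are ordered from left to right by increasing first elements. The flattened form $\mathrm{flat}(\pi)$ is the word (in one-line notation) obtained by erasing the parentheses of the standard cycle form. A derangement is a permutation with no fixed points; $\mathcal{D}(n)$ is the set of derangements of $[n]$, and $\mu(\pi)$ denotes the number of cycles of $\pi$. A word $w=w_1\cdots w_n$ of distinct integers contains the vincular pattern $3\text{-}12$ if there are indices $i<j$ with $j+1\le n$ and $w_j<w_{j+1}<w_i$, and avoids it otherwise. $\mathcal{D}_{3\text{-}12}(n)$ is the set of $\pi\in\mathcal{D}(n)$ such that $\mathrm{flat}(\pi)$ avoids $3\text{-}12$. All generating functions are formal power series in $x$; $[y^m]$ denotes coefficient extraction. *)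

(* Defs.v *)
From HB Require Import structures.
From mathcomp Require Import all_boot all_order all_algebra all_fingroup.
From mathcomp Require Import boolp classical_sets.

Set Implicit Arguments.
Unset Strict Implicit.
Unset Printing Implicit Defensive.

Import GRing.Theory.
Local Open Scope ring_scope.

(** * Formal power series in x *)

Record fps (R : Type) := Fps { fcoef : nat -> R }.

Arguments Fps {R} fcoef.
Arguments fcoef {R} f n.

Lemma fpsP (R : Type) (s t : fps R) : fcoef s =1 fcoef t -> s = t.
Proof. by case: s t => [s] [t] /= /funext ->. Qed.

HB.instance Definition _ (R : Type) := gen_eqMixin (fps R).
HB.instance Definition _ (R : Type) := gen_choiceMixin (fps R).

Section FpsRing.
Variable R : comNzRingType.
Implicit Types (s t r : fps R) (n : nat).

Definition fps_zero : fps R := Fps (fun=> 0).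
Definition fps_opp s : fps R := Fps (fun n => - fcoef s n).
Definition fps_add s t : fps R := Fps (fun n => fcoef s n + fcoef t n).
Definition fps_one : fps R := Fps (fun n => (n == 0%N)%:R).
Definition fps_mul s t : fps R :=
  Fps (fun n => \sum_(k < n.+1) fcoef s k * fcoef t (n - k)).

Fact fps_addA : associative fps_add.
Proof. by move=> s t r; apply: fpsP => n /=; rewrite addrA. Qed.
Fact fps_addC : commutative fps_add.
Proof. by move=> s t; apply: fpsP => n /=; rewrite addrC. Qed.
Fact fps_add0 : left_id fps_zero fps_add.
Proof. by move=> s; apply: fpsP => n /=; rewrite add0r. Qed.
Fact fps_addN : left_inverse fps_zero fps_opp fps_add.
Proof. by move=> s; apply: fpsP => n /=; rewrite addNr. Qed.

HB.instance Definition _ :=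
  GRing.isZmodule.Build (fps R) fps_addA fps_addC fps_add0 fps_addN.

Let trunc n s : {poly R} := \poly_(k < n.+1) fcoef s k.

Let coef_trunc n s k : (k <= n)%N -> (trunc n s)`_k = fcoef s k.
Proof. by move=> le_kn; rewrite coef_poly ltnS le_kn. Qed.

Let fps_mulE n s t (p q : {poly R}) :
    (forall k, (k <= n)%N -> p`_k = fcoef s k) ->
    (forall k, (k <= n)%N -> q`_k = fcoef t k) ->
  forall k, (k <= n)%N -> (p * q)`_k = fcoef (fps_mul s t) k.
Proof.
move=> ps qt k le_kn; rewrite coefM; apply: eq_bigr => i _.
by rewrite ps ?qt // ?(leq_trans (leq_subr _ _)) // (leq_trans _ le_kn) // -ltnS.
Qed.

Fact fps_mulA : associative fps_mul.
Proof.
move=> s t r; apply: fpsP => n; have T := @coef_trunc n.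
have st := fps_mulE (T s) (T t); have tr := fps_mulE (T t) (T r).
by rewrite -(fps_mulE (T s) tr) // -(fps_mulE st (T r)) // mulrA.
Qed.
Fact fps_mulC : commutative fps_mul.
Proof.
move=> s t; apply: fpsP => n; have T := @coef_trunc n.
by rewrite -(fps_mulE (T s) (T t)) // -(fps_mulE (T t) (T s)) // mulrC.
Qed.
Fact fps_mul1 : left_id fps_one fps_mul.
Proof.
move=> s; apply: fpsP => n /=; rewrite big_ord_recl /= mul1r subn0.
by rewrite big1 ?addr0 // => i _; rewrite mul0r.
Qed.
Fact fps_mulDl : left_distributive fps_mul fps_add.
Proof.
move=> s t r; apply: fpsP => n /=; rewrite -big_split /=.
by apply: eq_bigr => i _; rewrite mulrDl.
Qed.
Fact fps_one_neq0 : fps_one != fps_zero.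
Proof. by apply/eqP => /(congr1 (fcoef ^~ 0%N)) /= /eqP; rewrite oner_eq0. Qed.

HB.instance Definition _ := GRing.Zmodule_isComNzRing.Build (fps R)
  fps_mulA fps_mulC fps_mul1 fps_mulDl fps_one_neq0.

Lemma fcoefD s t n : fcoef (s + t) n = fcoef s n + fcoef t n. Proof. by []. Qed.
Lemma fcoef0 n : fcoef (0 : fps R) n = 0. Proof. by []. Qed.
Lemma fcoefM s t n :
  fcoef (s * t) n = \sum_(k < n.+1) fcoef s k * fcoef t (n - k).
Proof. by []. Qed.

Lemma fcoef_sum (I : Type) (l : seq I) (P : pred I) (F : I -> fps R) n :
  fcoef (\sum_(i <- l | P i) F i) n = \sum_(i <- l | P i) fcoef (F i) n.
Proof. exact: (big_morph (fcoef ^~ n) (fun s t => fcoefD s t n) (fcoef0 n)). Qed.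

Definition fpsC (c : R) : fps R := Fps (fun n => if n is 0 then c else 0).
Definition fpsX : fps R := Fps (fun n => (n == 1%N)%:R).

(* [S] is the sum of the series of general term [f], coefficientwise: for every
   n the coefficient of x^n of the partial sums is eventually that of [S]. *)
Definition fps_sums (f : nat -> fps R) (S : fps R) : Prop :=
  forall n, exists N, forall M, (N <= M)%N ->
    fcoef (\sum_(0 <= j < M) f j) n = fcoef S n.

(* The infinite sum \sum_(j >= 0) f j; it is 0 when the series diverges. *)
Definition fps_sum (f : nat -> fps R) : fps R := xget 0 [set S | fps_sums f S].

Lemma fps_sums_unique (f : nat -> fps R) S T :
  fps_sums f S -> fps_sums f T -> S = T.
Proof.
move=> fS fT; apply: fpsP => n; have [N hN] := fS n; have [N' hN'] := fT n.
by rewrite -(hN (maxn N N')) ?leq_maxl // hN' ?leq_maxr.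
Qed.

Lemma fps_sumP (f : nat -> fps R) S : fps_sums f S -> fps_sum f = S.
Proof.
by move=> fS; apply: (fps_sums_unique _ fS); apply: (@xgetI _ 0 _ S fS).
Qed.

(* A series whose j-th term is divisible by x^j converges. *)
Lemma fps_sum_val (f : nat -> fps R) :
    (forall j n, (n < j)%N -> fcoef (f j) n = 0) ->
  fps_sums f (fps_sum f) /\
  forall n, fcoef (fps_sum f) n = \sum_(j < n.+1) fcoef (f j) n.
Proof.
move=> f0; pose S := Fps (fun n => \sum_(j < n.+1) fcoef (f j) n).
have fS : fps_sums f S.
  move=> n; exists n.+1 => M lt_nM; rewrite fcoef_sum /=.
  rewrite (big_cat_nat (leq0n _) lt_nM) /= big_mkord [X in _ + X]big_nat_cond.
  by rewrite [X in _ + X]big1 ?addr0 // => j /andP[/andP[? _] _]; apply: f0.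
by rewrite (fps_sumP fS).
Qed.

End FpsRing.

Arguments fpsX {R}.

Section FpsUnit.
Variable R : comUnitRingType.
Implicit Types (s t : fps R) (n : nat).

(* [fps_inv_seq s n] lists the coefficients of x^0, ..., x^n of 1/s. *)
Fixpoint fps_inv_seq s n : seq R :=
  if n is n'.+1 then
    let l := fps_inv_seq s n' in
    rcons l (- (fcoef s 0)^-1 * \sum_(k < n'.+1) fcoef s k.+1 * l`_(n' - k))
  else [:: (fcoef s 0)^-1].

Definition fps_unit : pred (fps R) := fun s => fcoef s 0 \is a GRing.unit.
Definition fps_inv s : fps R :=
  if fps_unit s then Fps (fun n => (fps_inv_seq s n)`_n) else s.

Let size_fps_inv_seq s n : size (fps_inv_seq s n) = n.+1.
Proof. by elim: n => //= n IHn; rewrite size_rcons IHn. Qed.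

Let nth_fps_inv_seq s n k :
  (k <= n)%N -> (fps_inv_seq s n)`_k = (fps_inv_seq s k)`_k.
Proof.
elim: n => [|n IHn]; first by rewrite leqn0 => /eqP->.
rewrite leq_eqVlt => /predU1P[-> //|lt_kn] /=.
by rewrite nth_rcons size_fps_inv_seq lt_kn IHn.
Qed.

Fact fps_mulVr : {in fps_unit, left_inverse 1 fps_inv *%R}.
Proof.
move=> s Us; rewrite /fps_inv; have Us' : fps_unit s by []; rewrite Us' mulrC.
apply: fpsP => -[|n]; rewrite fcoefM.
  by rewrite big_ord_recl big_ord0 addr0 /= divrr.
rewrite big_ord_recl /= subn0 nth_rcons size_fps_inv_seq ltnn eqxx.
rewrite mulrA mulrN divrr // mulN1r; apply/eqP; rewrite addrC subr_eq0; apply/eqP.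
by apply: eq_bigr => i _; rewrite /= subSS [in RHS]nth_fps_inv_seq ?leq_subr.
Qed.

Fact fps_unitPl s t : t * s = 1 -> fps_unit s.
Proof.
move=> /(congr1 (fcoef ^~ 0%N)); rewrite fcoefM big_ord_recl big_ord0 addr0 => ts.
by apply/unitrPr; exists (fcoef t 0); rewrite mulrC.
Qed.

Fact fps_inv_out : {in [predC fps_unit], fps_inv =1 id}.
Proof. by move=> s /negPf Us; rewrite /fps_inv (Us : fps_unit s = false). Qed.

HB.instance Definition _ := GRing.ComNzRing_hasMulInverse.Build (fps R)
  fps_mulVr fps_unitPl fps_inv_out.

End FpsUnit.

(** * Permutations in standard cycle form *)

Section Flattened.
Variable n : nat.
Implicit Type p : 'S_n.

(* The element k : 'I_n stands for the letter k + 1 of [n]. *)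
Definition letter (k : 'I_n) : nat := k.+1.

Definition cycle_min p (k : 'I_n) : bool :=
  [forall l in porbit p k, (k <= l)%N].

(* [enum 'I_n] is increasing, and [traject p k m] is [:: k; p k; p (p k); ...]
   with m items. *)
Definition std_cycle_form p : seq (seq nat) :=
  [seq [seq letter l | l <- traject p k #|porbit p k|]
     | k <- enum 'I_n & cycle_min p k].

Definition flat p : seq nat := flatten (std_cycle_form p).

Definition derangement p : bool := [forall k, p k != k].

Definition num_cycles p : nat := #|porbits p|.

Definition last_cycle p : seq nat := last [::] (std_cycle_form p).

End Flattened.

Definition contains_3_12 (w : seq nat) : bool :=
  [exists i : 'I_(size w), exists j : 'I_(size w),
    [&& i < j, j.+1 < size w, nth 0 w j < nth 0 w j.+1
      & nth 0 w j.+1 < nth 0 w i]]%N.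

Definition D_3_12 (n : nat) : {set 'S_n} :=
  [set p | derangement p && ~~ contains_3_12 (flat p)].

(** * Generating functions *)

(* Q(u, v) *)
Definition coefField : fieldType := {fraction {poly {poly rat}}}.

Definition varu : fps coefField := fpsC (tofrac ('X%:P)).
Definition varv : fps coefField := fpsC (tofrac 'X).

(* The indeterminate of {poly coefField} is y. *)
Definition z (n i j : nat) : {poly coefField} :=
  \sum_(p in D_3_12 n | (head 0%N (last_cycle p) == i)
                     && (last 0%N (last_cycle p) == j)) 'X^(num_cycles p).

(* Power series not involving y, seen as power series over Q(u, v)[y]. *)
Definition fps_polyC (s : fps coefField) : fps {poly coefField} :=
  Fps (fun n => (fcoef s n)%:P).

(* Z(x, a, b) for power series a, b in x; Z(x, u, v) is [Z varu varv]. *)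
Definition Z (a b : fps coefField) : fps {poly coefField} :=
  fps_sum (fun k => let n := k.+2 in
    \sum_(1 <= i < n) \sum_(i.+1 <= j < n.+1)
      fpsC (z n i j) * fps_polyC a ^+ (n - 1 - i) * fps_polyC b ^+ (n - j)
        * fpsX ^+ n).

Definition Zm (m : nat) (a b : fps coefField) : fps coefField :=
  if m is 0 then 0 else Fps (fun n => (fcoef (Z a b) n)`_m).

Definition Zm' (m : nat) (a : fps coefField) : fps coefField :=
  match m with
  | 0 => 0
  | 1 => fpsX ^+ 2
  | _ => (- fpsX) ^+ m.+1 + fpsX * Zm m.-1 1 a
         - \sum_(2 <= j < m) (- fpsX) ^+ j * Zm (m - j) 1 1
  end.

(** * Well-definedness of the series and quotients *)

Lemma fcoefMXn (R : comNzRingType) (s : fps R) k n :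
  (n < k)%N -> fcoef (s * fpsX ^+ k) n = 0.
Proof.
elim: k s n => [|k IHk] s n // lt_nk; rewrite exprS mulrA.
have [lt_nk'|le_kn] := ltnP n k; first exact: IHk.
have sX0 : fcoef (s * fpsX) 0 = 0.
  by rewrite fcoefM big_ord_recl big_ord0 addr0 mulr0.
have {lt_nk le_kn} -> : n = k by apply/eqP; rewrite eqn_leq le_kn -ltnS lt_nk.
elim: k {IHk} (s * fpsX) sX0 => [|k IHk] t t0; first by rewrite mulr1.
rewrite exprSr mulrA mulrC fcoefM big_ord_recl mul0r add0r big_ord_recl.
rewrite subSS subn0 mul1r IHk // add0r big1 // => i _.
by rewrite /= mul0r.
Qed.

Lemma fps_sums_Z (a b : fps coefField) :
  fps_sums (fun k => let n := k.+2 in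
    \sum_(1 <= i < n) \sum_(i.+1 <= j < n.+1)
      fpsC (z n i j) * fps_polyC a ^+ (n - 1 - i) * fps_polyC b ^+ (n - j)
        * fpsX ^+ n) (Z a b).
Proof.
apply: (proj1 (fps_sum_val _)) => k n lt_nk; rewrite fcoef_sum big1_seq // => i _.
by rewrite fcoef_sum big1_seq // => j _; rewrite fcoefMXn // (ltn_trans lt_nk).
Qed.

Lemma fps_unit_series (s : fps coefField) : 1 - fpsX * s \is a GRing.unit.
Proof.
suff s0 : fcoef (1 - fpsX * s) 0 = 1 by rewrite unfold_in /= /fps_unit s0 unitr1.
by rewrite fcoefD /= big_ord_recl big_ord0 mul0r !addr0 oppr0 addr0.
Qed.

Lemma fps_unit_denom : 1 - varv - fpsX * varu * varv \is a GRing.unit.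
Proof.
suff s0 : fcoef (1 - varv - fpsX * varu * varv) 0 = tofrac (1 - 'X).
  rewrite unfold_in /= /fps_unit s0 unitfE tofrac_eq0 subr_eq0.
  by apply/eqP => /(congr1 (size \o val)) /=; rewrite size_polyX size_poly1.
rewrite -mulrA !fcoefD /= big_ord_recl big_ord0 mul0r !addr0 oppr0 addr0.
by rewrite tofracB tofrac1.
Qed.

Lemma fps_sums_power (s : fps coefField) (g : nat -> fps coefField) :
  let f j := (fpsX * s) ^+ j * g j in fps_sums f (fps_sum f).
Proof.
apply: (proj1 (fps_sum_val _)) => j n lt_nj.
by rewrite exprMn -mulrA mulrC fcoefMXn.
Qed.

(* Main.v *)
Require Import Defs.
From mathcomp Require Import all_boot all_order all_algebra perm.
From mathcomp Require Import boolp ring zify.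

(**
A word avoids 3-12 exactly when each of its letters is smaller than its
predecessor or larger than all the letters before it. Let a derangement have
last cycle (i, ..., j). If that cycle has at least three letters, deleting j and
standardizing leaves a derangement of the same kind with the same i and with
last letter j' such that j = n or i < j <= j', and every such j can be
reinserted. If it has two letters, then j = n, and deleting n and appending i to
the preceding cycle gives a derangement with one cycle less, whose last cycle is
not of length two. With Z'_m enumerating the second kind, this yields
  (1 - b - xab) Z_m(a,b) = (1-b) Z'_m(a) + xa(1-b) Z_m(a,1) - xab^2 Z_m(ab,1),
  Z'_m(a) = x Z_{m-1}(1,a) - x Z'_{m-1}(1)
for all power series a, b. When b = 1/(1+xa) the kernel on the left vanishes, so
Z_m(w,1) is expressed through Z_m(w/(1-xw),1), and iterating this expansion
gives the two infinite sums.
*)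

Set Implicit Arguments.
Unset Strict Implicit.
Unset Printing Implicit Defensive.

Import GRing.Theory.

(** * Standard cycle forms *)

Section CycleForm.
Variable n : nat.
Implicit Types (p q : 'S_n) (k l : 'I_n).

Lemma porbit_fconnect p k : porbit p k =i fconnect p k.
Proof.
move=> l; apply/porbitP/idP => [[i ->]|].
  by rewrite permX; apply: fconnect_iter.
by rewrite -topredE /= fconnect_orbit => /trajectP[i _ ->]; exists i; rewrite permX.
Qed.

Lemma traject_porbit p k : traject p k #|porbit p k| = fingraph.orbit p k.
Proof. by rewrite /fingraph.orbit /order (eq_card (porbit_fconnect p k)). Qed.

(** Letters stay in ['I_n] and cycles are [fingraph.orbit]s, so that the theory of functional cycles
    applies. *)
Definition ord_cycle_form p : seq (seq 'I_n) :=
  [seq fingraph.orbit p k | k <- enum 'I_n & cycle_min p k].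

Lemma std_cycle_formE p :
  std_cycle_form p = [seq [seq letter l | l <- c] | c <- ord_cycle_form p].
Proof.
by rewrite /std_cycle_form -map_comp; apply: eq_map => k /=; rewrite traject_porbit.
Qed.

(** The cycle is the orbit of the least element of [porbit p k]. *)
Lemma mem_ord_cycle p k :
  exists2 c, c \in ord_cycle_form p & k \in c.
Proof.
pose l := [arg min_(l < k in porbit p k) (l : nat)].
have [pl lmin] : l \in porbit p k /\ (forall i, i \in porbit p k -> l <= i).
  by rewrite /l; case: arg_minnP; [exact: porbit_id|].
have Ekl : porbit p l = porbit p k by apply/eqP; rewrite eq_porbit_mem.
exists (fingraph.orbit p l).
  apply: map_f; rewrite mem_filter mem_enum andbT.
  by apply/forall_inP => i; rewrite Ekl; apply: lmin.
by rewrite -fconnect_orbit; have := porbit_id p k; rewrite -Ekl porbit_fconnect.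
Qed.

Lemma cycle_min_le p k l : cycle_min p k -> l \in fingraph.orbit p k -> k <= l.
Proof.
move=> /forall_inP kmin; rewrite -fconnect_orbit => kl.
by apply: kmin; rewrite porbit_fconnect.
Qed.

Lemma cycle_min_uniq p k l i : cycle_min p k -> cycle_min p l ->
  i \in fingraph.orbit p k -> i \in fingraph.orbit p l -> k = l.
Proof.
move=> kmin lmin; rewrite -!fconnect_orbit => ki li.
have sym := fconnect_sym (@perm_inj _ p).
have kl : fconnect p k l by apply: connect_trans ki _; rewrite sym.
apply/val_inj/eqP; rewrite eqn_leq /= (cycle_min_le kmin) -?fconnect_orbit //.
by rewrite (cycle_min_le lmin) // -fconnect_orbit sym.
Qed.

Lemma uniq_flatten_ord_cycle_form p : uniq (flatten (ord_cycle_form p)).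
Proof.
rewrite /ord_cycle_form; set s := filter _ _.
have s_min : all (cycle_min p) s by apply: filter_all.
have s_uniq : uniq s by rewrite filter_uniq ?enum_uniq.
elim: s s_min s_uniq => //= k s IHs /andP[kmin s_min] /andP[ks s_uniq].
rewrite cat_uniq orbit_uniq IHs // andbT; apply/hasPn => i /flatten_mapP[l ls li].
apply: contra ks => ki; rewrite (@cycle_min_uniq p k l i) //.
exact: (allP s_min).
Qed.

Lemma perm_flatten_ord_cycle_form p :
  perm_eq (flatten (ord_cycle_form p)) (enum 'I_n).
Proof.
apply: uniq_perm; rewrite ?uniq_flatten_ord_cycle_form ?enum_uniq // => k.
rewrite mem_enum; apply/flattenP.
by have [c pc kc] := mem_ord_cycle p k; exists c.
Qed.

Lemma ord_cycle_form_fcycle p c : c \in ord_cycle_form p -> fcycle p c.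
Proof. by move=> /mapP[k _ ->]; apply/cycle_orbit/perm_inj. Qed.

(** A permutation sends each letter to its cyclic successor in the cycle containing it, and this can
    be read off the cycle form. *)
Lemma ord_cycle_form_inj : injective ord_cycle_form.
Proof.
move=> p q eq_pq; apply/permP => k; have [c pc kc] := mem_ord_cycle p k.
have := pc; rewrite eq_pq => /ord_cycle_form_fcycle /nextE <- //.
by rewrite (nextE (ord_cycle_form_fcycle pc)).
Qed.

(** Each orbit contains exactly one cycle minimum. *)
Lemma num_cyclesE p : num_cycles p = size (ord_cycle_form p).
Proof.
rewrite size_map /num_cycles.
have -> : porbits p = porbit p @: [set k | cycle_min p k].
  apply/setP => A; apply/imsetP/imsetP => [[k _ ->]|[k _ ->]]; last by exists k.
  have [c /mapP[l]] := mem_ord_cycle p k.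
  rewrite mem_filter => /andP[lmin _] -> kl; exists l; first by rewrite inE.
  by apply/eqP; rewrite eq_porbit_mem porbit_fconnect -topredE /= fconnect_orbit.
rewrite card_in_imset => [|k l].
  by rewrite cardE enumT; congr size; apply: eq_filter => k; rewrite !inE.
rewrite !inE => kmin lmin Ekl; apply: (@cycle_min_uniq p k l k) => //.
  by rewrite -fconnect_orbit connect0.
by rewrite -fconnect_orbit; have := porbit_id p k; rewrite Ekl porbit_fconnect.
Qed.

Lemma derangementE p : derangement p = all (fun c => 1 < size c) (ord_cycle_form p).
Proof.
apply/forallP/allP => [der c /mapP[k _ ->]|der k].
  rewrite size_orbit ltn_neqAle order_gt0 andbT; apply/eqP => o1.
  have := iter_order (@perm_inj _ p) k; rewrite -o1 /= => pk.
  by have := der k; rewrite pk eqxx.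
have [c pc kc] := mem_ord_cycle p k; apply/eqP => pk.
have := der c pc; have uc : uniq c.
  by have /mapP[l _ ->] := pc; apply: orbit_uniq.
have cc := ord_cycle_form_fcycle pc.
rewrite -(order_cycle cc uc kc) -size_orbit.
have /eq_card1 : fconnect p k =i pred1 k.
  move=> l; rewrite !inE; apply/idP/eqP => [|->]; last exact: connect0.
  rewrite fconnect_orbit => /trajectP[i _ ->].
  by elim: i => //= i ->.
by rewrite size_orbit /order => ->.
Qed.

(** * Lists of cycles that are standard cycle forms *)

Section Surjective.
Variable cs : seq (seq 'I_n).
Hypothesis cs_perm : perm_eq (flatten cs) (enum 'I_n).
Hypothesis cs_min : forall c, c \in cs ->
  exists2 k, ohead c = Some k & forall l, l \in c -> k <= l.
Hypothesis cs_sorted :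
  sorted (fun c d : seq 'I_n =>
    if (ohead c, ohead d) is (Some k, Some l) then k < l else false) cs.

Let cyc k := nth [::] cs (find (fun c => k \in c) cs).

Let has_cyc k : has (fun c => k \in c) cs.
Proof.
have : k \in flatten cs by rewrite (perm_mem cs_perm) mem_enum.
by move=> /flattenP[c cs_c kc]; apply/hasP; exists c.
Qed.

Let mem_cyc k : k \in cyc k. Proof. by have := nth_find [::] (has_cyc k). Qed.

Let cyc_mem k : cyc k \in cs. Proof. by rewrite mem_nth // -has_find. Qed.

Let uniq_flat : uniq (flatten cs).
Proof. by rewrite (perm_uniq cs_perm) enum_uniq. Qed.

Let cs_uniq c : c \in cs -> uniq c.
Proof.
move: uniq_flat; elim: (cs) => //= d ds IH; rewrite cat_uniq inE.
by move=> /and3P[ud _ uds] /predU1P[->|/IH ->].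
Qed.

Let cs_disj c d k : c \in cs -> d \in cs -> k \in c -> k \in d -> c = d.
Proof.
move: uniq_flat; elim: (cs) => //= e es IH; rewrite cat_uniq !inE.
move=> /and3P[ue /hasPn disj ues].
move=> /predU1P[->|ces] /predU1P[->|des] // kc kd; last exact: IH.
  by have /disj : k \in flatten es by [apply/flattenP; exists d]; rewrite /= kc.
by have /disj : k \in flatten es by [apply/flattenP; exists c]; rewrite /= kd.
Qed.

Let cycE c k : c \in cs -> k \in c -> cyc k = c.
Proof. by move=> csc kc; apply: (@cs_disj _ _ k). Qed.

(** This map is the permutation that realizes [cs]. *)
Let f k := next (cyc k) k.

Let f_inj : injective f.
Proof.
move=> k l; rewrite /f => eq_kl.
(* A common successor forces a common cycle, on which [prev] inverts [next]. *)
have Ekl : cyc k = cyc l.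
  by apply: (@cs_disj _ _ (next (cyc k) k)); rewrite // ?mem_next // eq_kl mem_next.
move: eq_kl; rewrite Ekl => /(can_inj (prev_next (cs_uniq (cyc_mem l)))).
by [].
Qed.

Let fcycle_cs c : c \in cs -> fcycle (perm f_inj) c.
Proof.
move=> csc; apply: cycle_from_next; first exact: cs_uniq.
by move=> k kc /=; rewrite permE /f (cycE csc kc).
Qed.

Lemma ord_cycle_form_surj : exists p, ord_cycle_form p = cs.
Proof.
pose p := perm f_inj; exists p.
have orbE c k : c \in cs -> ohead c = Some k -> fingraph.orbit p k = c.
  move=> csc ck; have kc : k \in c by case: c ck {csc} => //= ? ? [->]; rewrite mem_head.
  rewrite (orbitE (fcycle_cs csc) (cs_uniq csc) kc).
  by case: c ck {csc kc} => //= ? ? [->]; rewrite eqxx rot0.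
pose hs := pmap ohead cs.
have csE : cs = [seq fingraph.orbit p k | k <- hs].
  rewrite /hs; have : {subset cs <= cs} by [].
  elim: {1 3 4}(cs) => //= c ds IH sub.
  have csc : c \in cs by apply: sub; rewrite mem_head.
  have [k ck _] := cs_min csc; rewrite ck /= (orbE c) //; congr (_ :: _).
  by apply: IH => d dds; apply: sub; rewrite inE dds orbT.
rewrite [RHS]csE /ord_cycle_form; congr map.
have lt_trans : transitive (fun k l : 'I_n => k < l) by move=> ? ? ?; apply: ltn_trans.
(* The list of cycle minima and the list [hs] of heads are both strictly increasing, so having the
   same members makes them equal. *)
apply: (irr_sorted_eq lt_trans); first by move=> k; rewrite ltnn.
- apply: sorted_filter => //.
  by have := iota_ltn_sorted 0 n; rewrite -val_enum_ord sorted_map.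
- rewrite /hs; move: cs_sorted; case: {orbE csE hs} (cs) => //= c ds.
  case ck: (ohead c) => [k|] /=; last by case: ds => //= d ds; rewrite ck.
  elim: ds c k ck => //= d ds IH c k ck; rewrite ck.
  by case dl: (ohead d) => [l|] //= /andP[-> /=]; apply: IH.
move=> k; rewrite mem_filter mem_enum andbT mem_pmap.
apply/idP/idP => [kmin|/mapP[c csc ck]].
  have csc := cyc_mem k; have [l cl lmin] := cs_min csc.
  apply/mapP; exists (cyc k) => //; rewrite cl; congr Some.
  have ko : k \in fingraph.orbit p l by rewrite (orbE _ _ csc cl) mem_cyc.
  have lo : l \in fingraph.orbit p k.
    by move: ko; rewrite -!fconnect_orbit (fconnect_sym (@perm_inj _ p)).
  by apply/val_inj/eqP; rewrite eqn_leq /= (cycle_min_le kmin lo) lmin.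
have [l cl lmin] := cs_min csc; move: cl; rewrite -ck => -[kl].
apply/forall_inP => i; rewrite porbit_fconnect -topredE /= fconnect_orbit.
by rewrite (orbE c) // kl; apply: lmin.
Qed.

End Surjective.
End CycleForm.

(** * Codes of derangements avoiding 3-12 *)

(* Avoidance of 3-12 for a word that is read from right to left. *)
Fixpoint avoids (w : seq nat) : bool :=
  if w is a :: t then avoids t && ((a <= head 0 t) || all (fun b => b <= a) t)
  else true.

Lemma head_rev (T : Type) (x : T) s : head x (rev s) = last x s.
Proof. by case/lastP: s => //= s y; rewrite rev_rcons last_rcons. Qed.

Lemma last_rev (T : Type) (x : T) s : last x (rev s) = head x s.
Proof. by case: s => //= y s; rewrite rev_cons last_rcons. Qed.

Lemma contains_3_12P (w : seq nat) :
  reflect (exists i j, [/\ i < j, j.+1 < size w, nth 0 w j < nth 0 w j.+1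
                         & nth 0 w j.+1 < nth 0 w i])
          (contains_3_12 w).
Proof.
apply: (iffP existsP) => [[i /existsP[j /and4P[? ? ? ?]]]|[i [j [ij jw ? ?]]]].
  by exists i, j.
have jw' := ltnW jw; have iw := ltn_trans ij jw'.
by exists (Ordinal iw); apply/existsP; exists (Ordinal jw'); apply/and4P.
Qed.

(** An occurrence using the appended letter must end with it: the last two letters form the ascent,
    and some earlier letter exceeds [a]. *)
Lemma contains_3_12_rcons w a :
  contains_3_12 (rcons w a)
  = contains_3_12 w || (last 0 w < a) && has (fun b => a < b) w.
Proof.
apply/contains_3_12P/orP => [[i [j [ij]]]|[/contains_3_12P|/andP[wa]]].
- rewrite size_rcons ltnS => jw; rewrite !nth_rcons jw (ltn_trans ij jw).
  case: (ltngtP j.+1 (size w)) jw => [jw _ ? ?|//|jw _ ja ai]; last right.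
    by left; apply/contains_3_12P; exists i, j; split.
  rewrite -nth_last -jw /= ja; apply/hasP; exists (nth 0 w i) => //.
  by rewrite mem_nth // -jw ltnW.
- move=> [i [j [ij jw ? ?]]]; exists i, j.
  rewrite size_rcons !nth_rcons jw (ltnW jw) (ltn_trans ij (ltnW jw)).
  by split=> //; apply: leqW.
move=> /(has_nthP 0)[i iw ai]; exists i, (size w).-1.
have w_gt0 : 0 < size w by apply: leq_ltn_trans iw.
(* The last letter of [w] is below [a], so it is not the large letter at position [i]. *)
have i_neq : i != (size w).-1.
  by apply: contraTneq ai => ->; rewrite nth_last -leqNgt ltnW.
rewrite size_rcons !nth_rcons prednK // ltnn eqxx ltnS leqnn iw nth_last.
by split => //; rewrite ltn_neqAle i_neq -ltnS prednK.
Qed.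

(** Reversal turns appending a letter into [cons], along which [avoids] recurses. *)
Lemma contains_3_12_rev w : contains_3_12 w = ~~ avoids (rev w).
Proof.
elim/last_ind: w => [|w a IHw]; first by apply/contains_3_12P => -[? [? []]].
rewrite contains_3_12_rcons IHw rev_rcons /= negb_and negb_or head_rev -ltnNge.
congr (_ || _ && _); rewrite -has_predC has_rev; apply: eq_has => b /=.
by rewrite -ltnNge.
Qed.

(* Codes list the cycles from the last to the first, each cycle from its last
   letter to its first: [last 0 c] is the minimum of the cycle [c]. *)
Definition valid_code (n : nat) (r : seq (seq nat)) : bool :=
  [&& perm_eq (flatten r) (iota 1 n), all (fun c => 1 < size c) r,
      sorted gtn [seq last 0 c | c <- r],
      all (fun c => all (leq (last 0 c)) c) r & avoids (flatten r)].

Definition code n (p : 'S_n) : seq (seq nat) := rev [seq rev c | c <- std_cycle_form p].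

Lemma flatten_code n (p : 'S_n) : flatten (code p) = rev (flat p).
Proof. by rewrite rev_flatten. Qed.

Lemma size_code n (p : 'S_n) : size (code p) = num_cycles p.
Proof. by rewrite size_rev size_map std_cycle_formE size_map num_cyclesE. Qed.

Lemma head_code n (p : 'S_n) : head [::] (code p) = rev (last_cycle p).
Proof. by rewrite head_rev -{1}[[::]]/(rev [::]) last_map. Qed.

Lemma letter_inj n : injective (@letter n).
Proof. by move=> k l [] /val_inj. Qed.

Lemma map_letter_enum n : [seq letter k | k <- enum 'I_n] = iota 1 n.
Proof. by rewrite (map_comp succn val) val_enum_ord -(iotaDl 1 0 n). Qed.

Lemma code_inj n : injective (@code n).
Proof.
move=> p q /(can_inj revK) /(inj_map (can_inj revK)).
rewrite !std_cycle_formE => /(inj_map (inj_map (@letter_inj n))).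
exact: ord_cycle_form_inj.
Qed.

Lemma code_valid n (p : 'S_n) : p \in D_3_12 n -> valid_code n (code p).
Proof.
rewrite inE derangementE contains_3_12_rev negbK => /andP[der av].
rewrite /valid_code flatten_code av andbT.
have -> : perm_eq (rev (flat p)) (iota 1 n).
  rewrite perm_rev /flat std_cycle_formE -map_flatten -map_letter_enum.
  exact/perm_map/perm_flatten_ord_cycle_form.
have -> : all (fun c => 1 < size c) (code p).
  rewrite /code all_rev all_map std_cycle_formE all_map.
  by apply: sub_all der => c /=; rewrite size_rev size_map.
have lastE : [seq last 0 (rev c) | c <- std_cycle_form p]
             = [seq letter k | k <- enum 'I_n & cycle_min p k].
  rewrite std_cycle_formE -!map_comp; apply: eq_map => k /=.
  by rewrite last_rev /fingraph.orbit -orderSpred.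
rewrite /code map_rev -map_comp rev_sorted [map _ _]lastE /=; apply/andP; split.
  rewrite sorted_map; apply: sorted_filter; first by move=> ? ? ?; apply: ltn_trans.
  by have := iota_ltn_sorted 1 n; rewrite -map_letter_enum sorted_map.
rewrite all_rev all_map std_cycle_formE all_map; apply/allP => c /mapP[k].
rewrite mem_filter => /andP[kmin _] -> /=; rewrite last_rev all_rev all_map.
rewrite {1}/fingraph.orbit -orderSpred /=; apply/allP => l lk /=.
by rewrite ltnS (cycle_min_le kmin).
Qed.

Lemma valid_code_ex n r : valid_code n.+1 r ->
  exists2 p : 'S_n.+1, p \in D_3_12 n.+1 & code p = r.
Proof.
move=> /and5P[r_perm r_size r_sorted r_min r_av].
(* The inverse of [letter]; [inord] needs a nonempty ordinal type, whence the size [n.+1]. *)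
pose ord a : 'I_n.+1 := inord a.-1.
have ordK : {in flatten r, cancel ord (@letter n.+1)}.
  move=> a; rewrite (perm_mem r_perm) mem_iota => /andP[a0 an].
  by rewrite /letter inordK ?prednK // -ltnS prednK.
pose cs := [seq [seq ord a | a <- rev c] | c <- rev r].
have csK : [seq [seq letter l | l <- c] | c <- cs] = rev [seq rev c | c <- r].
  rewrite -map_comp -map_rev; apply/eq_in_map => c; rewrite mem_rev => rc /=.
  rewrite -map_comp map_id_in // => a; rewrite mem_rev => ac /=.
  by apply: ordK; apply/flattenP; exists c.
have cs_flat : [seq letter l | l <- flatten cs] = rev (flatten r).
  by rewrite map_flatten csK rev_flatten.
have cs_perm : perm_eq (flatten cs) (enum 'I_n.+1).
  apply: (@perm_map_inj _ _ _ (@letter_inj n.+1)).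
  by rewrite cs_flat map_letter_enum perm_rev.
have r_last c : c \in r -> last 0 c \in c.
  by move=> /(allP r_size); case: c => //= a c _; apply: mem_last.
have cs_head c : c \in r ->
    ohead [seq ord a | a <- rev c] = Some (ord (last 0 c)).
  by move=> /r_last; case/lastP: c => // c a _; rewrite rev_rcons last_rcons.
have r_ord c : c \in r -> letter (ord (last 0 c)) = last 0 c.
  by move=> rc; apply: ordK; apply/flattenP; exists c; rewrite ?r_last.
have cs_min c : c \in cs ->
    exists2 k, ohead c = Some k & forall l, l \in c -> k <= l.
  move=> /mapP[d]; rewrite mem_rev => rd ->; exists (ord (last 0 d)) => [|l].
    exact: cs_head.
  move=> /mapP[a]; rewrite mem_rev => da ->.
  suff: letter (ord (last 0 d)) <= letter (ord a) by [].
  rewrite r_ord // [letter _]ordK; first exact: (allP (allP r_min _ rd)).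
  by apply/flattenP; exists d.
have [|p pE] := ord_cycle_form_surj cs_perm cs_min.
  rewrite sorted_map rev_sorted; move: r_sorted; rewrite sorted_map.
  apply: sub_in_sorted (allss r) => c d rc rd /=.
  rewrite !cs_head // => lt_dc.
  suff: letter (ord (last 0 d)) < letter (ord (last 0 c)) by [].
  by rewrite (r_ord c) ?(r_ord d) ?r_last.
have scfE : std_cycle_form p = rev [seq rev c | c <- r].
  by rewrite std_cycle_formE pE csK.
have codeE : code p = r by rewrite /code scfE map_rev revK (mapK revK).
exists p => //; rewrite inE derangementE contains_3_12_rev negbK.
rewrite -flatten_code codeE r_av andbT pE all_map all_rev.
by apply: sub_all r_size => c /=; rewrite size_map size_rev.
Qed.

(** As duplicate-free lists, codes allow bijections to be stated with [perm_eq] and sums to be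
    transported by [perm_big]. *)
Definition codes n : seq (seq (seq nat)) := [seq code p | p <- enum (D_3_12 n)].

Lemma codes_uniq n : uniq (codes n).
Proof. by rewrite map_inj_uniq ?enum_uniq //; apply: code_inj. Qed.

Lemma mem_codes n r : (r \in codes n.+1) = valid_code n.+1 r.
Proof.
apply/mapP/idP => [[p]|/valid_code_ex[p Dp <-]].
  by rewrite mem_enum => /code_valid rv ->.
by exists p; rewrite ?mem_enum.
Qed.

(** * Inserting and splitting off the last letter *)

Definition last_start (r : seq (seq nat)) : nat := last 0 (head [::] r).
Definition last_letter (r : seq (seq nat)) : nat := head 0 (head [::] r).
Definition last_size (r : seq (seq nat)) : nat := size (head [::] r).

Lemma ltn_bump2 h i j : (bump h i < bump h j) = (i < j).
Proof. by rewrite !ltnNge leq_bump2. Qed.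

(** Raising by one the letters from [j] on undoes the standardization that follows a deletion of
    [j]. *)
Lemma perm_bump_iota j n (s : seq nat) : 0 < j <= n.+1 ->
  perm_eq (j :: [seq bump j a | a <- s]) (iota 1 n.+1) = perm_eq s (iota 1 n).
Proof.
move=> j_n.
have E : perm_eq (iota 1 n.+1) (j :: [seq bump j a | a <- iota 1 n]).
  apply: uniq_perm; first exact: iota_uniq.
    rewrite /= map_inj_uniq ?iota_uniq ?andbT; last exact: can_inj (bumpK j).
    by apply/mapP => -[a _ ja]; have := neq_bump j a; rewrite -ja eqxx.
  move=> a; rewrite mem_iota inE; apply/idP/idP.
    move=> a_n; case: (a =P j) => //= /eqP aj; apply/mapP; exists (unbump j a).
      by rewrite mem_iota /unbump; lia.
    by rewrite unbumpK.
  move=> /predU1P[->|/mapP[b]]; first by lia.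
  by rewrite mem_iota /bump => b_n ->; lia.
rewrite (permPr E) perm_cons; apply/idP/idP => [|/(perm_map _)]; last exact.
exact/perm_map_inj/(can_inj (bumpK j)).
Qed.

Lemma avoids_cons a s :
  avoids (a :: s) = avoids s && ((a <= head 0 s) || all (fun b => b <= a) s).
Proof. by []. Qed.

Lemma avoids_bump h s : avoids [seq bump h a | a <- s] = avoids s.
Proof.
elim: s => [|a [|b s] IHs] //; first by rewrite /= !orbT.
rewrite map_cons avoids_cons IHs [RHS]avoids_cons; congr (_ && (_ || _)).
  exact: leq_bump2.
by rewrite all_map; apply: eq_all => d /=; rewrite leq_bump2.
Qed.

Lemma flatten_nil (r : seq (seq nat)) :
  all (fun c => 1 < size c) r -> flatten r = [::] -> r = [::].
Proof. by case: r => // -[]. Qed.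

Lemma valid_code_cons n r : valid_code n.+1 r ->
  exists a b t r0, r = (a :: b :: t) :: r0.
Proof.
move=> /and3P[r_perm r_size _]; case: r r_perm r_size => [/perm_size|c r0 _] //=.
by case: c => [|a [|b t]] //= _; exists a, b, t, r0.
Qed.

(** The last cycle has at least two distinct letters and starts with its least one, so it ends
    strictly above its start. *)
Lemma valid_code_bounds n r : valid_code n.+1 r ->
  [/\ 0 < last_start r, last_start r < last_letter r & last_letter r <= n.+1].
Proof.
move=> rv; have [a [b [t [r0 rE]]]] := valid_code_cons rv.
move: rv; rewrite rE /last_start /last_letter => /and5P[r_perm _ _ r_min _] /=.
have mem_r d : d \in a :: b :: t -> 0 < d <= n.+1.
  move=> dc; have : d \in iota 1 n.+1.
    rewrite -(perm_mem r_perm); apply/flattenP.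
    by exists (a :: b :: t); rewrite ?mem_head.
  by rewrite mem_iota add1n ltnS.
have /andP[-> _] : 0 < last b t <= n.+1.
  by apply: mem_r; rewrite inE mem_last orbT.
have /andP[_ ->] : 0 < a <= n.+1 by apply: mem_r; rewrite mem_head.
split=> //; move: r_min => /= /andP[/andP[le_ta _] _].
rewrite ltn_neqAle le_ta andbT; apply: contraTneq (mem_last b t) => ->.
have: uniq (flatten ((a :: b :: t) :: r0)) by rewrite (perm_uniq r_perm) iota_uniq.
by move=> /= /andP[]; rewrite inE mem_cat !inE !negb_or => /and3P[-> ->].
Qed.

(** The two letters of the last cycle form an ascent at the end of the word, so avoidance makes the
    final letter the largest of all. *)
Lemma valid_code_last_size2 n r :
  valid_code n.+1 r -> last_size r = 2 -> last_letter r = n.+1.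
Proof.
move=> rv; have [lt0 lt1 lt2] := valid_code_bounds rv.
have [a [b [t [r0 rE]]]] := valid_code_cons rv.
move: rv lt1 lt2; rewrite rE /last_start /last_letter /last_size.
case: t rE => // rE /and5P[r_perm _ _ _ /= /andP[_ r_av]] ba an _.
move: r_av; rewrite leqNgt ba /= => /andP[_ /allP all_a].
have : n.+1 \in iota 1 n.+1 by rewrite mem_iota; lia.
rewrite -(perm_mem r_perm) /= !inE.
move=> /or3P[/eqP->//| /eqP|/all_a]; lia.
Qed.

(** Codes are read backwards: the head of the first list is the end of the last cycle. *)
Definition insert_letter j (r : seq (seq nat)) : seq (seq nat) :=
  if [seq [seq bump j a | a <- c] | c <- r] is c :: r' then (j :: c) :: r'
  else [::].

(* The letters that [insert_letter] may put after the last letter of a code. *)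
Definition slots n r : seq nat :=
  rcons (iota (last_start r).+1 (last_letter r - last_start r)) n.+1.

Lemma mem_slots n r j :
  (j \in slots n r) = (last_start r < j <= last_letter r) || (j == n.+1).
Proof. by rewrite mem_rcons inE mem_iota orbC; congr (_ || _); lia. Qed.

Lemma insert_letter_cons j c r : insert_letter j (c :: r)
  = (j :: [seq bump j a | a <- c]) :: [seq [seq bump j a | a <- d] | d <- r].
Proof. by []. Qed.

Lemma valid_code_consE n c r :
  valid_code n (c :: r)
  = [&& perm_eq (flatten (c :: r)) (iota 1 n), 1 < size c,
        all (fun d => 1 < size d) r, path gtn (last 0 c) [seq last 0 d | d <- r],
        all (leq (last 0 c)) c, all (fun d => all (leq (last 0 d)) d) r
      & avoids (flatten (c :: r))].
Proof. by rewrite /valid_code ![all _ (c :: r)]/= -!andbA. Qed.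

(** The conditions on the old letters are invariant under [bump j]. The new letter must exceed the
    start of its cycle and either lie below the raised old last letter or exceed every letter. *)
Lemma insert_letter_valid n j c r : 0 < j -> 1 < size c ->
  valid_code n.+2 (insert_letter j (c :: r))
  = valid_code n.+1 (c :: r) && (j \in slots n.+1 (c :: r)).
Proof.
move=> j0 c2; rewrite mem_slots.
have flatE : flatten (insert_letter j (c :: r))
             = j :: [seq bump j a | a <- flatten (c :: r)].
  by rewrite map_flatten.
(* A value above [n.+2] is neither a letter nor a slot, so both sides are false. *)
case: (leqP j n.+2) => [jn|nj]; last first.
  apply/idP/andP => [/andP[/perm_mem/(_ j)]|[/valid_code_bounds[]]].
    by rewrite flatE mem_head mem_iota => /esym; lia.
  lia.
(* The default [0] of [last] is fixed by [bump j] because [j] is positive. *)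
have lastE d : last 0 [seq bump j a | a <- d] = bump j (last 0 d).
  by rewrite -[in LHS](_ : bump j 0 = 0) ?last_map // /bump leqNgt j0.
have last_c : last 0 (j :: [seq bump j a | a <- c]) = bump j (last 0 c).
  by case: (c) c2 => //= b d _; rewrite last_map.
have sizesE : all (fun d => 1 < size d) [seq [seq bump j a | a <- d] | d <- r]
              = all (fun d => 1 < size d) r.
  by rewrite all_map; apply: eq_all => d /=; rewrite size_map.
have pathE : path gtn (bump j (last 0 c))
               [seq last 0 d | d <- [seq [seq bump j a | a <- d] | d <- r]]
             = path gtn (last 0 c) [seq last 0 d | d <- r].
  rewrite -map_comp (eq_map (g := bump j \o last 0)) // map_comp path_map.
  by apply: eq_path => a b /=; rewrite ltn_bump2.
have minE d : all (leq (bump j (last 0 d))) [seq bump j a | a <- d]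
              = all (leq (last 0 d)) d.
  by rewrite all_map; apply: eq_all => a /=; rewrite leq_bump2.
have minsE : all (fun d => all (leq (last 0 d)) d) [seq [seq bump j a | a <- d] | d <- r]
             = all (fun d => all (leq (last 0 d)) d) r.
  by rewrite all_map; apply: eq_all => d /=; rewrite lastE minE.
rewrite insert_letter_cons in flatE *.
rewrite !valid_code_consE flatE perm_bump_iota ?j0 // avoids_cons avoids_bump.
rewrite last_c sizesE pathE minsE [all (leq (bump _ _)) _]/= minE.
rewrite [size (j :: _)]/= size_map ltnS (ltnW c2) c2 -!andbA.
case r_perm: perm_eq => //; rewrite !andTb; do 2!bool_congr.
do 3![rewrite andbCA; bool_congr].
(* Only the two conditions on the new letter remain: minimality of the start of its cycle, and
   avoidance. *)
have -> : (bump j (last 0 c) <= j) = (last 0 c < j) by rewrite /bump; lia.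
have -> : head 0 [seq bump j a | a <- flatten (c :: r)] = bump j (head 0 c).
  by case: (c) c2.
have -> : (j <= bump j (head 0 c)) = (j <= head 0 c) by rewrite /bump; lia.
rewrite all_map /last_start /last_letter [flatten _]/(c ++ flatten r).
have mem_r a : (a \in c ++ flatten r) = (0 < a <= n.+1).
  by rewrite (perm_mem r_perm) mem_iota add1n ltnS.
(* For smaller [j] the largest old letter [n.+1] is raised to [n.+2], above [j]. *)
have -> : all (preim (bump j) (leq^~ j)) (c ++ flatten r) = (j == n.+2).
  apply/allP/eqP => [all_j|-> a]; last by rewrite mem_r /= /bump; lia.
  by have := all_j n.+1; rewrite mem_r /= /bump; lia.
have : last 0 c \in c ++ flatten r.
  by rewrite mem_cat; case: (c) c2 => //= a d _; rewrite mem_last.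
rewrite mem_r /=; lia.
Qed.

Lemma insert_letter_ex n r : valid_code n.+2 r -> last_size r != 2 ->
  exists j c r0, [/\ 0 < j, 1 < size c & r = insert_letter j (c :: r0)].
Proof.
move=> rv; have [_ lt2 _] := valid_code_bounds rv.
have [j [b [t [r1 rE]]]] := valid_code_cons rv.
rewrite rE /last_size; case: t rE => // d t rE _.
have j0 : 0 < j by move: lt2; rewrite rE /last_start /last_letter /=; lia.
exists j, [seq unbump j a | a <- b :: d :: t], [seq [seq unbump j a | a <- e] | e <- r1].
split=> //; rewrite /insert_letter.
have : uniq (flatten r) by case/andP: rv => /perm_uniq ->; rewrite iota_uniq.
rewrite rE => /= /andP[j_r _].
(* Letters are distinct, so none of the others equals [j] and [bump j] undoes [unbump j]. *)
have bK (e : seq nat) : {subset e <= b :: d :: t ++ flatten r1} ->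
    [seq bump j a | a <- [seq unbump j a | a <- e]] = e.
  move=> sub; rewrite -map_comp map_id_in // => a ae /=; rewrite unbumpK //.
  by rewrite inE; apply: contraNneq j_r => <-; apply: sub.
congr ((_ :: _) :: _).
  rewrite -[LHS](bK (b :: d :: t)) // => a.
  by rewrite !inE mem_cat => /or3P[->|->|->]; rewrite ?orbT.
rewrite -map_comp map_id_in // => e er /=; rewrite bK // => a ae.
by rewrite !inE mem_cat; apply/or4P/Or44/flattenP; exists e.
Qed.

Lemma insert_letter_inj j k r s : insert_letter j r = insert_letter k s ->
  r != [::] -> s != [::] -> (r, j) = (s, k).
Proof.
case: r s => [|c r] [|d s] //= [<- cd rs] _ _.
have inj : injective (map (bump j)) by apply/inj_map/can_inj/bumpK.
by rewrite (inj _ _ cd) (inj_map inj rs).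
Qed.

(** This bijection underlies the recurrence [Zcoef_rec]. *)
Lemma perm_insert_letter n :
  perm_eq [seq r <- codes n.+2 | last_size r != 2]
          [seq insert_letter j r | r <- codes n.+1, j <- slots n.+1 r].
Proof.
have codesP r : r \in codes n.+1 -> exists2 c, 1 < size c & exists r0, r = c :: r0.
  rewrite mem_codes => /valid_code_cons[a [b [t [r0 ->]]]].
  by exists (a :: b :: t) => //; exists r0.
apply: uniq_perm; first by rewrite filter_uniq ?codes_uniq.
  apply: allpairs_uniq_dep; first exact: codes_uniq.
    move=> r; rewrite mem_codes => rv; rewrite rcons_uniq iota_uniq mem_iota andbT.
    by have [] := valid_code_bounds rv; lia.
  move=> [r j] [s k] /allpairsPdep[r' [j' [cr' _ [-> ->]]]].
  move=> /allpairsPdep[s' [k' [cs' _ [-> ->]]]] /= eq_rs.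
  have [c _ [r0 rE]] := codesP _ cr'; have [d _ [s0 sE]] := codesP _ cs'.
  have := insert_letter_inj eq_rs; rewrite rE sE => /(_ isT isT)[-> -> ->].
  by [].
move=> r; rewrite mem_filter mem_codes.
apply/andP/allpairsPdep => [[r2 rv]|[s [j [cs js ->]]]].
  have [j [c [r0 [j0 c2 rE]]]] := insert_letter_ex rv r2.
  move: rv; rewrite rE insert_letter_valid // => /andP[rv jr].
  by exists (c :: r0), j; rewrite mem_codes.
have [c c2 [r0 sE]] := codesP _ cs; rewrite mem_codes in cs.
have j0 : 0 < j.
  by have [] := valid_code_bounds cs; move: js; rewrite mem_slots; lia.
rewrite sE insert_letter_valid // -sE cs js; split=> //.
by rewrite sE /last_size /= size_map; case: (c) c2 => [|? []].
Qed.

(** * Splitting the last letter off into a new cycle of length two *)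

Definition split_letter n (r : seq (seq nat)) : seq (seq nat) :=
  if r is (i :: c) :: r0 then [:: n.+1; i] :: c :: r0 else [::].

(** The flattened word only gains its maximum [n.+1] at the end, which creates no 3-12. *)
Lemma split_letter_valid n i c r : 1 < size c ->
  valid_code n.+1 ([:: n.+1; i] :: c :: r) = valid_code n ((i :: c) :: r).
Proof.
move=> c2; rewrite !valid_code_consE.
have -> : perm_eq (flatten ([:: n.+1; i] :: c :: r)) (iota 1 n.+1)
          = perm_eq (flatten ((i :: c) :: r)) (iota 1 n).
  have -> : iota 1 n.+1 = rcons (iota 1 n) n.+1.
    by rewrite -[in LHS](addn1 n) iotaD cats1 add1n.
  by rewrite perm_sym perm_rcons perm_cons perm_sym.
case r_perm: perm_eq => //; rewrite !andTb.
have mem_r a : (a \in i :: c ++ flatten r) = (0 < a <= n).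
  by rewrite (perm_mem r_perm) mem_iota add1n ltnS.
have i_n : 0 < i <= n by rewrite -mem_r mem_head.
have -> : avoids (flatten ([:: n.+1; i] :: c :: r)) = avoids (flatten ((i :: c) :: r)).
  rewrite [LHS]avoids_cons (_ : all _ _ = true) ?orbT ?andbT //.
  apply/allP => a ar; have := mem_r a.
  by rewrite (ar : a \in i :: c ++ flatten r) /=; lia.
have -> : last 0 (i :: c) = last 0 c by case: (c) c2.
(* Since [i] differs from the start of [c], the strict increase of the cycle starts amounts to the
   minimality of that start in the unsplit cycle. *)
have -> : path gtn (last 0 [:: n.+1; i]) [seq last 0 d | d <- c :: r]
          = (last 0 c <= i) && path gtn (last 0 c) [seq last 0 d | d <- r].
  rewrite /= [in RHS]leq_eqVlt; case: eqP => // i_last.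
  have : uniq (i :: c ++ flatten r) by rewrite (perm_uniq r_perm) iota_uniq.
  by rewrite /= mem_cat -i_last; case: (c) c2 => //= a d _; rewrite mem_last.
have -> : all (leq (last 0 [:: n.+1; i])) [:: n.+1; i] by rewrite /= leqnn; lia.
rewrite ![all _ (c :: r)]/= c2 [size (i :: c)]/= ltnS (ltnW c2).
rewrite [all _ (i :: c)]/= -!andbA !andTb; bool_congr.
by rewrite andbCA.
Qed.

Lemma perm_split_letter n :
  perm_eq [seq r <- codes n.+3 | last_size r == 2]
          [seq split_letter n.+2 r | r <- codes n.+2 & last_size r != 2].
Proof.
have codesP r : (r \in [seq r <- codes n.+2 | last_size r != 2]) ->
    valid_code n.+2 r /\ exists i c r0, r = (i :: c) :: r0 /\ 1 < size c.
  rewrite mem_filter mem_codes => /andP[r2 rv]; split=> //.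
  have [i [b [t [r0 rE]]]] := valid_code_cons rv; exists i, (b :: t), r0.
  by split=> //; move: r2; rewrite rE; case: (t).
apply: uniq_perm; first by rewrite filter_uniq ?codes_uniq.
  rewrite map_inj_in_uniq ?filter_uniq ?codes_uniq // => r s.
  by move=> /codesP[_ [? [? [? [-> _]]]]] /codesP[_ [? [? [? [-> _]]]]] /= [-> -> ->].
move=> r; rewrite mem_filter mem_codes; apply/andP/mapP => [[r2 rv]|[s]].
  have an := valid_code_last_size2 rv (eqP r2).
  have [a [i [t [r0 rE]]]] := valid_code_cons rv.
  move: r2 an rv; rewrite {}rE /last_size; case: t => // _.
  rewrite /last_letter /= => -> rv.
  (* There are more than two letters, so a preceding cycle exists to which [i] can be appended. *)
  have : size (flatten ([:: n.+3; i] :: r0)) = n.+3.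
    by case/andP: rv => /perm_size ->; rewrite size_iota.
  case: r0 rv => [|c r0] // rv _.
  have c2 : 1 < size c by case/and3P: rv => _ /and3P[].
  exists ((i :: c) :: r0) => //; rewrite mem_filter mem_codes -split_letter_valid // rv.
  by case: (c) c2 => [|? []].
move=> /codesP[sv [i [c [r0 [sE c2]]]]] ->; rewrite sE /= in sv *.
by rewrite split_letter_valid.
Qed.

(** * Derangements of one and two letters *)

Lemma codes1 : codes 1 = [::].
Proof.
case E: (codes 1) => [//|r s]; have : r \in codes 1 by rewrite E mem_head.
rewrite mem_codes => rv; have [a [b [t [r0 rE]]]] := valid_code_cons rv.
by case/andP: rv => /perm_size; rewrite rE.
Qed.

Lemma codes2 : codes 2 = [:: [:: [:: 2; 1]]].
Proof.
apply: perm_small_eq => //; apply: uniq_perm => [| |r]; rewrite ?codes_uniq //.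
rewrite mem_codes inE; apply/idP/eqP => [rv|-> //].
have [lt0 lt1 lt2] := valid_code_bounds rv.
have [a [b [t [r0 rE]]]] := valid_code_cons rv.
case/and3P: (rv) => /perm_size; rewrite rE /= size_cat => -[].
case: t rE => [|//] rE /= /size0nil r0E r_size _.
have r0nil : r0 = [::] by apply: flatten_nil.
move: lt0 lt1 lt2; rewrite rE r0nil /last_start /last_letter /= => b0 ba a2.
by congr [:: [:: _; _]]; lia.
Qed.

(** * Generating functions *)

Local Open Scope ring_scope.

(** * Convergent sums of power series *)

Section FpsSums.
Variable R : comNzRingType.
Implicit Types (s t S T : fps R) (f g : nat -> fps R).

Lemma eq_fps_sums f g S : f =1 g -> fps_sums f S -> fps_sums g S.
Proof.
move=> fg fS n; have [N hN] := fS n; exists N => M /hN <-; congr (fcoef _ n).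
by apply: eq_bigr => j _; rewrite fg.
Qed.

Lemma fps_sumsD f g S T :
  fps_sums f S -> fps_sums g T -> fps_sums (fun k => f k + g k) (S + T).
Proof.
move=> fS gT n; have [N hN] := fS n; have [N' hN'] := gT n.
exists (maxn N N') => M; rewrite geq_max => /andP[/hN fM /hN' gM].
by rewrite big_split /= fM gM.
Qed.

Lemma fps_sumsMl s f S : fps_sums f S -> fps_sums (fun k => s * f k) (s * S).
Proof.
move=> fS n.
(* One bound for all coefficients of index at most [n], the only ones that enter coefficient [n] of
   the product. *)
have [N hN] : exists N, forall k M, (k <= n)%N -> (N <= M)%N ->
    fcoef (\sum_(0 <= j < M) f j) k = fcoef S k.
  elim: n => [|n [N hN]].
    by have [N hN] := fS 0; exists N => k M; rewrite leqn0 => /eqP-> /hN.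
  have [N' hN'] := fS n.+1; exists (maxn N N') => k M.
  rewrite geq_max leq_eqVlt => /predU1P[->|kn] /andP[NM NM']; first exact: hN'.
  exact: hN.
exists N => M NM; rewrite -mulr_sumr !fcoefM.
by apply: eq_bigr => k _; rewrite hN // leq_subr.
Qed.

Lemma fps_sumsS f S : fps_sums (fun k => f k.+1) S -> fps_sums f (f 0 + S).
Proof.
move=> fS n; have [N hN] := fS n; exists N.+1 => -[//|M] /hN fM.
by rewrite big_nat_recl // !fcoefD fM.
Qed.

Lemma fps_sums0 : fps_sums (fun=> 0 : fps R) 0.
Proof. by move=> n; exists 0 => M _; rewrite big1. Qed.

Lemma fcoefCM (c : R) s n : fcoef (fpsC c * s) n = c * fcoef s n.
Proof.
by rewrite fcoefM big_ord_recl subn0 big1 ?addr0 // => i _; rewrite mul0r.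
Qed.

Lemma fpsCD (c d : R) : fpsC (c + d) = fpsC c + fpsC d.
Proof. by apply: fpsP => -[|n] //=; rewrite addr0. Qed.

Lemma fpsC0 : fpsC 0 = 0 :> fps R. Proof. by apply: fpsP => -[]. Qed.
Lemma fpsC1 : fpsC 1 = 1 :> fps R. Proof. by apply: fpsP => -[]. Qed.

Lemma fpsXM_eq0 s : fpsX * s = 0 -> s = 0.
Proof.
move=> Xs0; apply: fpsP => n; have := congr1 (fcoef ^~ n.+1) Xs0.
rewrite /= big_ord_recl mul0r add0r big_ord_recl subSS subn0 mul1r.
by rewrite big1 ?addr0 // => i _; rewrite mul0r.
Qed.

End FpsSums.

Local Notation K := coefField.
Implicit Types a b w s t : fps K.

(** * Extraction of the coefficient of [y^m] *)

Lemma fps_polyCM s t : fps_polyC (s * t) = fps_polyC s * fps_polyC t.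
Proof.
apply: fpsP => n /=; rewrite (raddf_sum polyC).
by apply: eq_bigr => k _ /=; rewrite polyCM.
Qed.

Lemma fps_polyCX s k : fps_polyC (s ^+ k) = fps_polyC s ^+ k.
Proof.
elim: k => [|k IHk]; last by rewrite !exprS fps_polyCM IHk.
by apply: fpsP => -[|n].
Qed.

Lemma fps_polyC_fpsX : fps_polyC fpsX = fpsX.
Proof. by apply: fpsP => -[|[|n]]. Qed.

Lemma fps_polyC_term (c : {poly K}) a b p q n :
  fpsC c * fps_polyC a ^+ p * fps_polyC b ^+ q * fpsX ^+ n
  = fpsC c * fps_polyC (a ^+ p * b ^+ q * fpsX ^+ n).
Proof. by rewrite 2!fps_polyCM 3!fps_polyCX fps_polyC_fpsX !mulrA. Qed.

Definition fps_coefy (m : nat) (s : fps {poly K}) : fps K :=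
  Fps (fun n => (fcoef s n)`_m).

Lemma fps_coefyD m (s t : fps {poly K}) :
  fps_coefy m (s + t) = fps_coefy m s + fps_coefy m t.
Proof. by apply: fpsP => n /=; rewrite coefD. Qed.

Lemma fps_coefy0 m : fps_coefy m 0 = 0.
Proof. by apply: fpsP => n /=; rewrite coef0. Qed.

Lemma fps_coefy_sum m (I : Type) (l : seq I) (P : pred I) (F : I -> fps {poly K}) :
  fps_coefy m (\sum_(i <- l | P i) F i) = \sum_(i <- l | P i) fps_coefy m (F i).
Proof. exact: (big_morph _ (fps_coefyD m) (fps_coefy0 m)). Qed.

Lemma fps_coefyM m (c : {poly K}) s :
  fps_coefy m (fpsC c * fps_polyC s) = fpsC c`_m * s.
Proof.
apply: fpsP => n; rewrite fcoefCM -[LHS]/((fcoef (fpsC c * fps_polyC s) n)`_m).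
by rewrite fcoefCM coefMC.
Qed.

Lemma fps_sums_coefy m (f : nat -> fps {poly K}) S :
  fps_sums f S -> fps_sums (fun k => fps_coefy m (f k)) (fps_coefy m S).
Proof.
move=> fS n; have [N hN] := fS n; exists N => M /hN fM.
by rewrite -fps_coefy_sum /= fM.
Qed.

(** The contribution of [n] letters to [Z_m(x,a,b)], without the factor [x^n]. It is itself a series
    in [x], because [a] and [b] are. *)
Definition Zcoef n m a b : fps K :=
  \sum_(r <- codes n | size r == m)
    a ^+ (n - 1 - last_start r) * b ^+ (n - last_letter r).

(* When the last cycle has two letters, its last letter is [n], so there is no
   second variable; [Z2 m] below is the series Z'_m. *)
Definition Zcoef2 n m a : fps K :=
  \sum_(r <- codes n | (size r == m) && (last_size r == 2%N))
    a ^+ (n - 1 - last_start r).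

Lemma coef_z n i j m :
  (z n i j)`_m = \sum_(r <- codes n | (last_start r == i) && (last_letter r == j))
                   (size r == m)%:R.
Proof.
rewrite coef_sum big_map -big_enum_cond /=; apply: eq_big => p.
  by rewrite /last_start /last_letter head_code last_rev head_rev.
by move=> _; rewrite coefXn size_code eq_sym.
Qed.

Lemma Zm_term n m a b :
  fps_coefy m (\sum_(1 <= i < n.+1) \sum_(i.+1 <= j < n.+2)
      fpsC (z n.+1 i j) * fps_polyC a ^+ (n.+1 - 1 - i) * fps_polyC b ^+ (n.+1 - j)
        * fpsX ^+ n.+1)
  = Zcoef n.+1 m a b * fpsX ^+ n.+1.
Proof.
rewrite fps_coefy_sum /Zcoef mulr_suml.
pose A i j := a ^+ (n.+1 - 1 - i) * b ^+ (n.+1 - j) * fpsX ^+ n.+1.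
transitivity (\sum_(1 <= i < n.+1) \sum_(r <- codes n.+1) \sum_(i.+1 <= j < n.+2)
    if (size r == m) && (last_start r == i) && (last_letter r == j)
    then A i j else 0).
  apply: eq_bigr => i _; rewrite fps_coefy_sum exchange_big; apply: eq_bigr => j _.
  rewrite fps_polyC_term fps_coefyM coef_z.
  rewrite (big_morph _ (@fpsCD _) (@fpsC0 _)) mulr_suml big_mkcond /=.
  apply: eq_bigr => r _; rewrite -andbA andbC.
  case: (_ && _); case: (size r == m) => //.
    by rewrite mulr1n fpsC1 mul1r.
  by rewrite mulr0n fpsC0 mul0r.
rewrite exchange_big [RHS]big_mkcond /=; apply: eq_big_seq => r; rewrite mem_codes => rv.
have [lt0 lt1 lt2] := valid_code_bounds rv.
case: (size r == m) => /=; last by rewrite big1 // => i _; rewrite big1.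
(* A code contributes for a single pair [(i, j)], which [valid_code_bounds] places inside the
   summation ranges. *)
transitivity (\sum_(1 <= i < n.+1 | i == last_start r)
   \sum_(i.+1 <= j < n.+2 | j == last_letter r) A i j).
  rewrite [RHS]big_mkcond; apply: eq_bigr => i _; rewrite eq_sym.
  case: (_ == _) => /=; last by rewrite big1.
  by rewrite [RHS]big_mkcond; apply: eq_bigr => j _; rewrite eq_sym.
rewrite big_nat1_eq lt0 (leq_trans lt1 lt2) /=.
by rewrite big_nat1_eq lt1 ltnS lt2.
Qed.

Lemma Zm_sums m a b : (0 < m)%N ->
  fps_sums (fun k => Zcoef k.+2 m a b * fpsX ^+ k.+2) (Zm m a b).
Proof.
case: m => // m _; have := fps_sums_coefy m.+1 (fps_sums_Z a b).
by apply: eq_fps_sums => k; rewrite Zm_term.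
Qed.

(** * Recurrences in the number of letters *)

Lemma Zcoef1 m a b : Zcoef 1 m a b = 0.
Proof. by rewrite /Zcoef codes1 big_nil. Qed.

(** Starting at one letter, where the term vanishes, aligns the terms of [x Z_m] with those for
    [k.+2] letters. *)
Lemma Zm_sums1 m a b : (0 < m)%N ->
  fps_sums (fun k => Zcoef k.+1 m a b * fpsX ^+ k.+1) (Zm m a b).
Proof.
move=> /(Zm_sums a b) /(@fps_sumsS _ (fun k => Zcoef k.+1 m a b * fpsX ^+ k.+1)).
by rewrite Zcoef1 mul0r add0r.
Qed.

(** The geometric sum over the slots [i < j <= i + d], which telescopes. *)
Lemma sum_pow_iota b N i d : (i + d <= N)%N ->
  (1 - b) * (\sum_(j <- iota i.+1 d) b ^+ (N - j)) = b ^+ (N - (i + d)) - b ^+ (N - i).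
Proof.
elim: d i => [|d IHd] i le_N; first by rewrite big_nil mulr0 addn0 subrr.
rewrite big_cons mulrDr IHd ?addSnnS // (_ : N - i = (N - i.+1).+1)%N; last by lia.
by rewrite exprS; ring.
Qed.

Lemma Zcoef_rec n m a b :
  (1 - b) * Zcoef n.+2 m a b
  = (1 - b) * Zcoef2 n.+2 m a + a * (1 - b) * Zcoef n.+1 m a 1
    + a * b * (Zcoef n.+1 m a b - b * Zcoef n.+1 m (a * b) 1).
Proof.
(* A code whose last cycle has two letters ends with [n.+2], so [b] has exponent zero there. *)
rewrite {1}/Zcoef (bigID (fun r => last_size r == 2%N)) /= mulrDr -addrA.
congr (_ * _ + _).
  rewrite big_seq_cond [RHS]big_seq_cond; apply: eq_bigr => r /and3P[].
  by rewrite mem_codes => rv _ /eqP /(valid_code_last_size2 rv) ->; rewrite subnn mulr1.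
under eq_bigl => r do rewrite andbC.
rewrite -big_filter_cond (perm_big _ (perm_insert_letter n)) /=.
rewrite big_mkcond big_allpairs_dep /=.
(* For each shorter code, the slot [n.+2] gives the first summand, and the geometric sum over the
   other slots gives the difference in the second. *)
transitivity (\sum_(r <- codes n.+1 | size r == m)
    (a * (1 - b) * (a ^+ (n.+1 - 1 - last_start r) * 1 ^+ (n.+1 - last_letter r))
     + a * b * (a ^+ (n.+1 - 1 - last_start r) * b ^+ (n.+1 - last_letter r)
       - b * ((a * b) ^+ (n.+1 - 1 - last_start r) * 1 ^+ (n.+1 - last_letter r)))));
  last by rewrite big_split -!mulr_sumr sumrB -mulr_sumr.
rewrite [RHS]big_mkcond mulr_sumr; apply: eq_big_seq => r; rewrite mem_codes => rv.
have [lt0 lt1 lt2] := valid_code_bounds rv.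
have size_ins j : size (insert_letter j r) = size r.
  by case: (r) => //= c r0; rewrite size_map.
under eq_bigr => j _ do rewrite size_ins.
case: (size r == m); last by rewrite big1 ?mulr0.
(* Every slot exceeds the start of the last cycle, which [bump j] therefore fixes. *)
have start_ins j : j \in slots n.+1 r -> last_start (insert_letter j r) = last_start r.
  rewrite mem_slots => j_r.
  have [c [d [t [r0 rE]]]] := valid_code_cons rv.
  move: lt1 lt2 j_r; rewrite rE /last_start /last_letter /= last_map /bump; lia.
have letter_ins j : last_letter (insert_letter j r) = j.
  by have [c [d [t [r0 ->]]]] := valid_code_cons rv.
under eq_big_seq => j jr do rewrite start_ins // letter_ins.
rewrite -mulr_sumr big_rcons /= subnn mulrDr mulrDr.
set i := last_start r in lt0 lt1 *; set j := last_letter r in lt1 lt2 *.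
rewrite mulrCA sum_pow_iota; last by lia.
rewrite (_ : i + (j - i) = j)%N; last by lia.
rewrite !subSS !subn0 (_ : n.+1 - i = (n - i).+1)%N; last by lia.
rewrite (_ : n.+2 - j = (n.+1 - j).+1)%N; last by lia.
rewrite (_ : n.+2 - i = (n - i).+2)%N; last by lia.
by rewrite exprMn !expr1n !exprS; ring.
Qed.

Lemma Zcoef0 n a b : Zcoef n.+1 0 a b = 0.
Proof.
rewrite /Zcoef big_seq_cond big1 // => r /andP[]; rewrite mem_codes.
by move=> /valid_code_cons[? [? [? [? ->]]]].
Qed.

Lemma Zcoef2_0 n a : Zcoef2 n.+1 0 a = 0.
Proof.
rewrite /Zcoef2 big_seq_cond big1 // => r /andP[]; rewrite mem_codes.
by move=> /valid_code_cons[? [? [? [? ->]]]].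
Qed.

Lemma Zcoef2_2 m a : Zcoef2 2 m.+1 a = (m == 0%N)%:R.
Proof.
rewrite /Zcoef2 codes2 big_cons big_nil /= addr0 andbT eq_sym eqSS eq_sym.
by case: (m).
Qed.

(** The codes to be split are all those of [n.+2] letters except the ones with a two-letter last
    cycle. The old last letter becomes the new start, so [a] moves to the second argument of
    [Zcoef]. *)
Lemma Zcoef2_rec n m a :
  Zcoef2 n.+3 m.+1 a = Zcoef n.+2 m 1 a - Zcoef2 n.+2 m 1.
Proof.
rewrite {1}/Zcoef2; under eq_bigl => r do rewrite andbC.
rewrite -big_filter_cond (perm_big _ (perm_split_letter n)) /= big_map big_filter_cond /=.
rewrite /Zcoef [X in _ = X - _](bigID (fun r => last_size r == 2%N)) /=.
rewrite [X in _ = X - _]addrC.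
have -> : \sum_(r <- codes n.+2 | (size r == m) && (last_size r == 2%N))
    1 ^+ (n.+2 - 1 - last_start r) * a ^+ (n.+2 - last_letter r) = Zcoef2 n.+2 m 1.
  rewrite /Zcoef2 big_seq_cond [RHS]big_seq_cond; apply: eq_bigr => r /and3P[].
  by rewrite mem_codes => rv _ /eqP /(valid_code_last_size2 rv) ->; rewrite subnn mulr1.
rewrite addrK big_seq_cond [RHS]big_seq_cond; apply: eq_big => r.
  case: (boolP (r \in codes _)) => //=; rewrite mem_codes => /valid_code_cons.
  by move=> [i [c [t [r0 ->]]]] /=; rewrite andbC.
rewrite mem_codes => /andP[/valid_code_cons[i [c [t [r0 ->]]]] _].
by rewrite expr1n mul1r /last_start /last_letter /= subn1.
Qed.

(** * Functional equations for the series *)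

Definition Z2 m a : fps K := fps_sum (fun k => Zcoef2 k.+2 m a * fpsX ^+ k.+2).

Lemma Z2_sums m a : fps_sums (fun k => Zcoef2 k.+2 m a * fpsX ^+ k.+2) (Z2 m a).
Proof.
apply: (proj1 (fps_sum_val _)) => j n lt_nj.
by rewrite fcoefMXn // (ltn_trans lt_nj).
Qed.

Lemma Z2_1 a : Z2 1 a = fpsX ^+ 2.
Proof.
apply: fps_sumP; rewrite -[X in fps_sums _ X]addr0.
rewrite [X in X + _](_ : _ = Zcoef2 2 1 a * fpsX ^+ 2); last first.
  by rewrite Zcoef2_2 mul1r.
apply: (@fps_sumsS _ (fun k => Zcoef2 k.+2 1 a * fpsX ^+ k.+2)).
apply: eq_fps_sums (@fps_sums0 _) => k.
by rewrite Zcoef2_rec Zcoef0 Zcoef2_0 subr0 mul0r.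
Qed.

Lemma Z2_rec m a : Z2 m.+2 a = fpsX * Zm m.+1 1 a - fpsX * Z2 m.+1 1.
Proof.
apply: fps_sumP; rewrite -[X in fps_sums _ X]add0r.
rewrite [X in X + _](_ : _ = Zcoef2 2 m.+2 a * fpsX ^+ 2); last first.
  by rewrite Zcoef2_2 mul0r.
apply: (@fps_sumsS _ (fun k => Zcoef2 k.+2 m.+2 a * fpsX ^+ k.+2)).
have ZS := fps_sumsMl fpsX (@Zm_sums m.+1 1 a isT).
have Z2S := fps_sumsMl (- fpsX) (Z2_sums m.+1 1).
rewrite -mulNr; apply: eq_fps_sums (fps_sumsD ZS Z2S) => k.
by rewrite Zcoef2_rec [in RHS]exprS; ring.
Qed.

(** The alternating sum that defines [Zm'] is this recurrence unrolled down to [x^2]. *)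
Lemma Zm'_rec m a : Zm' m.+2 a = fpsX * Zm m.+1 1 a - fpsX * Zm' m.+1 1.
Proof.
case: m => [|m]; first by rewrite /Zm' big_geq //; ring.
rewrite /Zm' -[m.+2.-1]/m.+1 -[m.+3.-1]/m.+2 big_nat_recl //=.
under eq_bigr => j _ do rewrite subSS exprS -mulrA.
rewrite -mulr_sumr !subSS subn0; set s := \sum_(_ <= _ < _) _.
by rewrite [in LHS]exprS; ring.
Qed.

Lemma Zm'E m a : (0 < m)%N -> Zm' m a = Z2 m a.
Proof.
case: m => // m _; elim: m a => [|m IHm] a; first by rewrite Z2_1.
by rewrite Zm'_rec Z2_rec IHm.
Qed.

(** This is [Zcoef_rec] multiplied by [x^(k+2)] and summed over [k]; uniqueness of limits gives the
    equality. *)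
Lemma Zm_functional m a b : (0 < m)%N ->
  (1 - b - fpsX * a * b) * Zm m a b
  = (1 - b) * Z2 m a + fpsX * a * (1 - b) * Zm m a 1
    - fpsX * a * b ^+ 2 * Zm m (a * b) 1.
Proof.
move=> m0; suff E : (1 - b) * Zm m a b
    = (1 - b) * Z2 m a + fpsX * a * (1 - b) * Zm m a 1
      + (fpsX * a * b * Zm m a b + - (fpsX * a * b ^+ 2) * Zm m (a * b) 1).
  move: (Zm m a b) (Z2 m a) (Zm m a 1) (Zm m (a * b) 1) E => A B C D E.
  by rewrite mulrBl E; ring.
apply: fps_sums_unique (fps_sumsMl _ (Zm_sums a b m0)) _.
have S1 := fps_sumsMl (1 - b) (Z2_sums m a).
have S2 := fps_sumsMl (fpsX * a * (1 - b)) (Zm_sums1 a 1 m0).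
have S3 := fps_sumsMl (fpsX * a * b) (Zm_sums1 a b m0).
have S4 := fps_sumsMl (- (fpsX * a * b ^+ 2)) (Zm_sums1 (a * b) 1 m0).
apply: eq_fps_sums (fps_sumsD (fps_sumsD S1 S2) (fps_sumsD S3 S4)) => k /=.
rewrite [RHS]mulrA Zcoef_rec [fpsX ^+ k.+2]exprS.
move: (Zcoef k.+1 m a b) (Zcoef2 k.+2 m a) (Zcoef k.+1 m a 1) => A B C.
by move: (Zcoef k.+1 m (a * b) 1) => D; ring.
Qed.

(** * The kernel method *)

Lemma fps_sums_remainder (f : nat -> fps K) S w (t : nat -> fps K) :
  (forall M, S = \sum_(0 <= j < M) f j + (fpsX * w) ^+ M * t M) -> fps_sums f S.
Proof.
(* The remainder is divisible by [x^M], so it does not reach the coefficient of [x^n] once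
   [M > n]. *)
move=> fS n; exists n.+1 => M lt_nM; rewrite [in RHS](fS M) fcoefD.
by rewrite exprMn -mulrA mulrC fcoefMXn // addr0.
Qed.

(* [1 - b = x a b] is the vanishing of the kernel of [Zm_functional]. *)
Lemma Zm_kernel m a b w : (0 < m)%N -> w \is a GRing.unit ->
  a * b = w -> 1 - b = fpsX * w ->
  b * Zm m w 1 = Z2 m a + fpsX * a * Zm m a 1.
Proof.
move=> m0 Uw ab kern; have := Zm_functional a b m0.
rewrite ab; move: (Zm m w 1) (Zm m a 1) (Z2 m a) (Zm m a b) => A B C D.
rewrite expr2 mulrA -(mulrA fpsX a b) ab kern subrr mul0r => E.
(* The equation is the claim times [x * w]. The unit [w] cancels, and [x], though not invertible,
   cancels by [fpsXM_eq0]. *)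
apply/esym/eqP; rewrite -subr_eq0; apply/eqP/(mulrI Uw).
by rewrite mulr0; apply: fpsXM_eq0; rewrite [RHS]E; ring.
Qed.

(** With [a = w / d'] and [b = d' / d] one has [a b = w / d], and the vanishing of the kernel
    becomes [d - d' = x w]. *)
Lemma Zm_kernel_ratio m w d d' : (0 < m)%N ->
  w \is a GRing.unit -> d \is a GRing.unit -> d' \is a GRing.unit ->
  d - d' = fpsX * w ->
  d' / d * Zm m (w / d) 1 = Z2 m (w / d') + fpsX * (w / d') * Zm m (w / d') 1.
Proof.
move=> m0 Uw Ud Ud' dd'.
have Uwd : w / d \is a GRing.unit by apply: (rpred_div Uw Ud).
have ab : w / d' * (d' / d) = w / d by rewrite mulrA divrK.
have kern : 1 - d' / d = fpsX * (w / d).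
  by rewrite -{1}(divrr Ud) -mulrBl mulrA dd'.
exact: (Zm_kernel m0 Uwd ab kern).
Qed.

(** The remainder after [M] terms is the next term plus the next remainder. Here [p] stands for the
    product of the first [M] denominators, and [d], [d'] for the denominators of index [M] and
    [M.+1]. *)
Lemma kernel_step (R : comUnitRingType) (x w p d p' d' A A' B : R) M :
  p \is a GRing.unit -> d \is a GRing.unit -> d' \is a GRing.unit ->
  p' = p * d' -> d' / d * A = B + x * (w / d') * A' ->
  (x * w) ^+ M * ((p * d)^-1 * A)
  = (x * w) ^+ M / p' * B + (x * w) ^+ M.+1 * ((p' * d')^-1 * A').
Proof.
move=> Up Ud Ud' -> E.
have -> : (p * d)^-1 = (p * d')^-1 * (d' / d).
  by rewrite !invrM // mulrA (mulrAC _ _ d') mulVr // mul1r mulrC.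
have Upd : p * d' \is a GRing.unit by rewrite unitrM Up.
by rewrite -[_ * A]mulrA E exprS (invrM Upd Ud'); ring.
Qed.

Lemma kernel_iterate (f g : fps K -> fps K) w (d : nat -> fps K) :
  d 0 = 1 -> (forall k, d k \is a GRing.unit) ->
  (forall k, d k.+1 / d k * f (w / d k)
             = g (w / d k.+1) + fpsX * (w / d k.+1) * f (w / d k.+1)) ->
  fps_sums (fun j => (fpsX * w) ^+ j / \prod_(1 <= i < j.+2) d i
                     * g (w / d j.+1)) (f w).
Proof.
move=> d0 Ud fg; pose P M := \prod_(1 <= i < M.+1) d i.
have UP M : P M \is a GRing.unit by apply: rpred_prod => i _; apply: Ud.
have PS M : P M.+1 = P M * d M.+1 by rewrite /P big_nat_recr.
(* Solving the relation for [f (w / d k)] and substituting [M] times leaves this cofactor of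
   [(x w)^M]. *)
apply: (@fps_sums_remainder _ _ w (fun M => (P M * d M)^-1 * f (w / d M))).
elim=> [|M IHM].
  by rewrite /P !big_geq // d0 divr1 mulr1 invr1 add0r !mul1r.
rewrite [LHS]IHM (big_nat_recr _ _ _ (leq0n M)).
rewrite -[RHS]addrA.
congr (_ + _).
rewrite -[\prod_(_ <= _ < _) _]/(P M.+1).
exact: (kernel_step _ (UP M) (Ud M) (Ud M.+1) (PS M) (fg M)).
Qed.

(** The denominators [1 - k x w] start at [1], are invertible, and have consecutive differences
    [x w], as [Zm_kernel_ratio] requires. *)
Lemma Zm_kernel_sum m w : (0 < m)%N -> w \is a GRing.unit ->
  fps_sums (fun j => (fpsX * w) ^+ j / \prod_(1 <= i < j.+2) (1 - i%:R * (fpsX * w))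
                     * Z2 m (w / (1 - j.+1%:R * (fpsX * w)))) (Zm m w 1).
Proof.
move=> m0 Uw.
apply: (@kernel_iterate (Zm m ^~ 1) (Z2 m) w (fun k => 1 - k%:R * (fpsX * w))).
- by rewrite mul0r subr0.
- by move=> k; rewrite mulrCA fps_unit_series.
move=> k; apply: (Zm_kernel_ratio m0 Uw).
- by rewrite mulrCA fps_unit_series.
- by rewrite mulrCA fps_unit_series.
by rewrite -natr1; ring.
Qed.

(** The parameters [t] and [e] allow for different bracketings of the products in numerators and
    denominators. *)
Lemma Zm_kernel_fps_sum m w t (e : nat -> fps K) : (0 < m)%N ->
  w \is a GRing.unit -> t = fpsX * w -> (forall i, e i = i%:R * (fpsX * w)) ->
  fps_sum (fun j => t ^+ j / \prod_(1 <= i < j.+2) (1 - e i)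
                    * Zm' m (w / (1 - e j.+1))) = Zm m w 1.
Proof.
move=> m0 Uw -> eE; have {eE}-> : e = fun i => i%:R * (fpsX * w) by apply: funext.
apply: fps_sumP; apply: eq_fps_sums (Zm_kernel_sum m0 Uw) => j.
by rewrite -(Zm'E _ m0).
Qed.

Lemma solve_kernel (R : comUnitRingType) (D A B C E xu v : R) :
  D \is a GRing.unit ->
  D * A = (1 - v) * B + xu * (1 - v) * E - xu * v ^+ 2 * C ->
  A = (1 - v) / D * B - xu * v ^+ 2 / D * C + xu * (1 - v) / D * E.
Proof.
move=> UD kern; rewrite -[LHS](mulKr UD) kern; ring.
Qed.

Theorem theorem3p3 (m : nat) (hm : (1 <= m)%N) :
  let x : fps coefField := fpsX in
  let u := varu in
  let v := varv in
  Zm m u v =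
    (1 - v) / (1 - v - x * u * v) * Zm' m u
    - x * u * v ^+ 2 / (1 - v - x * u * v)
      * fps_sum (fun j =>
          (x * u * v) ^+ j / \prod_(1 <= i < j.+2) (1 - i%:R * x * u * v)
          * Zm' m (u * v / (1 - j.+1%:R * x * u * v)))
    + x * u * (1 - v) / (1 - v - x * u * v)
      * fps_sum (fun j =>
          (x * u) ^+ j / \prod_(1 <= i < j.+2) (1 - i%:R * x * u)
          * Zm' m (u / (1 - j.+1%:R * x * u))).
Proof.
move=> x u v.
(* Both variables are nonzero constants of the field [Q(u,v)], hence invertible series, as the
   kernel argument needs. *)
have Uu : u \is a GRing.unit.
  by rewrite unfold_in /= /fps_unit unitfE tofrac_eq0 polyC_eq0 polyX_eq0.
have Uv : v \is a GRing.unit.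
  by rewrite unfold_in /= /fps_unit unitfE tofrac_eq0 polyX_eq0.
have Uuv : u * v \is a GRing.unit by rewrite unitrM Uu Uv.
have sum_uv : fps_sum (fun j =>
      (x * u * v) ^+ j / \prod_(1 <= i < j.+2) (1 - i%:R * x * u * v)
      * Zm' m (u * v / (1 - j.+1%:R * x * u * v))) = Zm m (u * v) 1.
  apply: (@Zm_kernel_fps_sum m (u * v) (x * u * v) (fun i => i%:R * x * u * v)) => //.
    exact/esym/mulrA.
  by move=> i; rewrite !mulrA.
have sum_u : fps_sum (fun j =>
      (x * u) ^+ j / \prod_(1 <= i < j.+2) (1 - i%:R * x * u)
      * Zm' m (u / (1 - j.+1%:R * x * u))) = Zm m u 1.
  apply: (@Zm_kernel_fps_sum m u (x * u) (fun i => i%:R * x * u)) => //.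
  by move=> i; rewrite mulrA.
(* With the infinite sums identified as [Z_m(x,uv,1)] and [Z_m(x,u,1)], the claim is the functional
   equation divided by the kernel. *)
rewrite [X in _ = _ - _ * X + _]sum_uv.
rewrite [X in _ = _ + _ * X]sum_u.
rewrite [Zm' m u](Zm'E u hm).
exact: (solve_kernel fps_unit_denom (Zm_functional u v hm)).
Qed.
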